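(* Let $G$ be a graph with $m$ vertices and $H$ an $r$-regular graph with $n$ vertices. Let $p$ be a prime with $n\equiv 0\pmod p$. If $\Gamma$ is an Abelian group with $p^2$ elements, then the composition $G[H]$ is $\Gamma$-vertex magic.
   Context: Graphs are finite, simple and undirected. For an additive Abelian group $\Gamma$ with identity $0$ and a graph $G$, a $\Gamma$-vertex magic labeling is a map $\ell:V(G)\to\Gamma\setminus\{0\}$ for which there is $\mu\in\Gamma$ with $w(v)=\sum_{u\in N(v)}\ell(u)=\mu$ for every vertex $v$; $G$ is $\Gamma$-vertex magic if it has such a labeling. The composition (lexicographic product) $G[H]$ has vertex set $V(G)\times V(H)$, with $(g,h)\sim(g',h')$ iff $g\sim g'$ in $G$, or $g=g'$ and $h\sim h'$ in $H$. *)

(* Defs.v *)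
From HB Require Import structures.
From mathcomp Require Import all_boot all_order all_algebra.

Set Implicit Arguments.
Unset Strict Implicit.
Unset Printing Implicit Defensive.

Import GRing.Theory.
Local Open Scope ring_scope.

Record sgraph := SGraph {
  vertex :> finType;
  adj : rel vertex;
  adj_sym : symmetric adj;
  adj_irrefl : irreflexive adj
}.

Definition neighbors (G : sgraph) (v : G) : {set G} := [set u | adj v u].

Definition regular (r : nat) (G : sgraph) : Prop :=
  forall v : G, #|neighbors v| = r.

Section Composition.
Variables G H : sgraph.

Definition comp_adj : rel (G * H)%type := fun x y =>
  adj x.1 y.1 || (x.1 == y.1) && adj x.2 y.2.

Lemma comp_adj_sym : symmetric comp_adj.
Proof.
by move=> x y; rewrite /comp_adj (adj_sym x.1) (adj_sym x.2) [x.1 == _]eq_sym.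
Qed.

Lemma comp_adj_irrefl : irreflexive comp_adj.
Proof. by move=> x; rewrite /comp_adj !adj_irrefl andbF. Qed.

Definition composition : sgraph := SGraph comp_adj_sym comp_adj_irrefl.

End Composition.

Section VertexMagic.
Variables (A : zmodType) (G : sgraph).

Definition weight (l : G -> A) (v : G) : A := \sum_(u in neighbors v) l u.

Definition vertex_magic_labeling (l : G -> A) : Prop :=
  (forall v, l v != 0) /\ exists mu : A, forall v, weight l v = mu.

Definition vertex_magic : Prop := exists l : G -> A, vertex_magic_labeling l.

End VertexMagic.

(* Main.v *)
(** Label every vertex with the same element [a] of order [p]: each copy of [H]
    attached to a neighbour in [G] contributes [n a = 0], so every weight is
    [r a]. *)
Require Import Defs.
From mathcomp Require Import all_boot all_order all_algebra.

Set Implicit Arguments.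
Unset Strict Implicit.
Unset Printing Implicit Defensive.

Import GRing.Theory.
Local Open Scope ring_scope.

(* Translation by [x] permutes [A], hence preserves the sum of its elements. *)
Lemma mulr_card_eq0 (A : finZmodType) (x : A) : x *+ #|A| = 0.
Proof.
have : \sum_(y : A) y = \sum_(y : A) (y + x).
  exact: (reindex_inj (addIr x)).
by rewrite big_split /= sumr_const -[LHS]addr0 => /addrI.
Qed.

(** Multiplication by [p ^ 2] kills [A]. So for a nonzero [d], here the difference of two distinct
    elements, either [d *+ p = 0] and [d] serves, or [d *+ p] is nonzero and is itself killed by
    [p]. *)
Lemma exists_ptorsion (A : finZmodType) (p : nat) :
  prime p -> #|A| = (p ^ 2)%N -> exists2 a : A, a != 0 & a *+ p = 0.
Proof.
move=> p_prime cardA.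
have /card_gt1P[x [y [_ _ xNy]]] : (1 < #|A|)%N.
  by rewrite cardA -(exp1n 2) ltn_exp2r ?prime_gt1.
have a_neq0 : x - y != 0 by rewrite subr_eq0.
have [pa0|pa_neq0] := eqVneq ((x - y) *+ p) 0; first by exists (x - y).
by exists ((x - y) *+ p) => //; rewrite -mulrnA mulnn -cardA mulr_card_eq0.
Qed.

(** A neighbour of [(g, h)] lies either anywhere in the copy of [H] over a neighbour of [g], or in
    the copy over [g] itself, next to [h]. *)
Lemma card_neighbors_composition (G H : sgraph) (g : G) (h : H) :
  #|@neighbors (composition G H) (g, h)| =
    (#|neighbors g| * #|H| + #|neighbors h|)%N.
Proof.
have -> : @neighbors (composition G H) (g, h) =
    setX (neighbors g) [set: H] :|: setX [set g] (neighbors h).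
  by apply/setP=> -[g' h']; rewrite !inE /= /comp_adj /= andbT (eq_sym g).
(* The two pieces are disjoint: a common vertex would make [g] adjacent to itself. *)
rewrite cardsU [X in (_ - #|pred_of_set X|)%N](_ : _ = set0).
  by rewrite cards0 subn0 !cardsX cards1 cardsT mul1n.
apply/setP=> -[g' h']; rewrite !inE andbT.
by case: eqP => [->|_]; rewrite ?adj_irrefl ?andbF.
Qed.

Local Close Scope ring_scope.

Theorem theorem3p8 (m n r p : nat) (G H : sgraph) (A : finZmodType)
  (cardG : #|G| = m) (regH : regular r H) (cardH : #|H| = n)
  (p_prime : prime p) (p_n : n = 0 %[mod p]) (cardA : #|A| = p ^ 2) :
  vertex_magic A (composition G H).
Proof.
have [a a_neq0 pa0] := exists_ptorsion p_prime cardA.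
exists (fun=> a); split=> //; exists (a *+ r)%R => -[g h].
have /dvdnP[k nE] : p %| n by rewrite /dvdn p_n mod0n.
(* The degree of [g] may vary, but it enters the weight only multiplied by [k * p], which kills
   [a]. *)
rewrite /weight sumr_const card_neighbors_composition regH cardH nE.
by rewrite mulnA mulrnDr mulnC mulrnA pa0 mul0rn add0r.
Qed.
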